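(* Any (uniform or non-uniform) DNF on multiplication tables of order $n$ that evaluates to $1$ on all Cayley tables of groups of order $n$ and to $0$ on all other multiplication tables must have at least $n!/n^{\log n}\ge 2^{n\log n-O(n)}$ terms. Hence the same lower bound holds for the number of terms of DNFs deciding Group Isomorphism on pairs of tables of order $n$. For Latin squares instead of groups (i.e. DNFs that evaluate to $1$ exactly on the tables of order $n$ that are Latin squares), the analogous lower bound on the number of terms is $(n!)^{2n}/n^{n^2}\ge 2^{n^2\log n-O(n^2)}$.
   Context: A multiplication table of order $n$ is an $n\times n$ table describing a binary operation on $[n]$, each entry encoded by $\lceil\log_2 n\rceil$ bits, so a single table is described by $N=n^2\lceil\log_2 n\rceil$ Boolean variables. The Cayley tables of groups are those tables that define a group operation on $[n]$; a Latin square is a table in which every row and every column is a permutation of $[n]$ (equivalently, the multiplication table of a quasigroup). Group Isomorphism: given a pair of tables of order $n$, decide whether both are multiplication tables of groups and these groups are isomorphic. Logarithms are base $2$. *)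

(* Defs.v *)
From HB Require Import structures.
From mathcomp Require Import all_boot all_order all_algebra.
From mathcomp Require Import all_classical all_reals all_analysis.
Set Implicit Arguments.
Unset Strict Implicit.
Unset Printing Implicit Defensive.
Import Order.TTheory GRing.Theory Num.Theory.
Local Open Scope ring_scope.

(* A literal [(v, b)] is satisfied when variable [v] has value [b]. *)
Definition literal (V : Type) : Type := (V * bool)%type.
Definition term (V : Type) : Type := seq (literal V).
Definition dnf (V : Type) : Type := seq (term V).

Definition term_eval (V : Type) (t : term V) (x : V -> bool) : bool :=
  all (fun l : literal V => x l.1 == l.2) t.
Definition dnf_eval (V : Type) (D : dnf V) (x : V -> bool) : bool :=
  has (fun t : term V => term_eval t x) D.
Definition num_terms (V : Type) (D : dnf V) : nat := size D.

Definition table (n : nat) : Type := 'M['I_n]_n.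
Definition table_op (n : nat) (T : table n) (i j : 'I_n) : 'I_n := T i j.

(* [up_log 2 n] is the ceiling of the binary logarithm of [n] for [n > 0]. *)
Definition entry_bits (n : nat) : nat := up_log 2 n.
Definition encoding (n : nat) : Type := 'I_n -> (entry_bits n).-tuple bool.

(* The variable [(i, j, k)] is the [k]-th bit of the entry in cell [(i, j)]. *)
Definition table_var (n : nat) : finType :=
  ('I_n * 'I_n * 'I_(entry_bits n))%type.

Lemma card_table_var (n : nat) : #|table_var n| = (n ^ 2 * up_log 2 n)%N.
Proof. by rewrite !card_prod !card_ord mulnn. Qed.

Definition encode (n : nat) (enc : encoding n) (T : table n) :
    table_var n -> bool :=
  fun v => tnth (enc (T v.1.1 v.1.2)) v.2.

Definition encode_pair (n : nat) (enc : encoding n) (A B : table n) :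
    table_var n + table_var n -> bool :=
  fun v => match v with inl u => encode enc A u | inr u => encode enc B u end.

Definition is_group_table (n : nat) (T : table n) : Prop :=
  exists (e : 'I_n) (inv : 'I_n -> 'I_n),
    [/\ associative (table_op T),
        left_id e (table_op T), right_id e (table_op T),
        left_inverse e inv (table_op T) & right_inverse e inv (table_op T)].

Definition isomorphic_tables (n : nat) (A B : table n) : Prop :=
  exists2 f : 'I_n -> 'I_n, bijective f
    & {morph f : x y / table_op A x y >-> table_op B x y}.

Definition is_latin_square (n : nat) (T : table n) : Prop :=
  (forall i : 'I_n, bijective (fun j : 'I_n => T i j)) /\
  (forall j : 'I_n, bijective (fun i : 'I_n => T i j)).

(* When [n] is not a power of 2 some assignments encode no table; the values
   of [D] on these are left unconstrained in the next two definitions. *)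
Definition dnf_decides (n : nat) (enc : encoding n) (D : dnf (table_var n))
    (P : table n -> Prop) : Prop :=
  forall T : table n, dnf_eval D (encode enc T) <-> P T.

Definition dnf_decides_group_iso (n : nat) (enc : encoding n)
    (D : dnf (table_var n + table_var n)) : Prop :=
  forall A B : table n, dnf_eval D (encode_pair enc A B) <->
    [/\ is_group_table A, is_group_table B & isomorphic_tables A B].

Definition log2 (R : realType) (x : R) : R := ln x / ln 2.

Definition group_bound (R : realType) (n : nat) : R :=
  n`!%:R / n%:R `^ log2 n%:R.
Definition latin_bound (R : realType) (n : nat) : R :=
  n`!%:R ^+ (2 * n) / n%:R ^+ (n ^ 2).

(* Main.v *)
(* A term accepting two tables also accepts every table obtained by mixing their
   entries. Two distinct tables A, B accepted by one term would thus give an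
   accepted table differing from the Latin square A in a single cell, which is not
   a Latin square; so a DNF has at least as many terms as there are accepted tables.
   - Groups: relabelling Z/n by permutations s gives n! tables, and s is recovered
     from the table and the image of the generator, so at least n!/n are distinct.
   - Latin squares: a k x n Latin rectangle extends by one row in per(A) ways, A being
     an (n-k)-regular 0/1 matrix, and per(A) >= (n-k)^n n!/n^n by van der Waerden's
     bound. The latter is proved by Gurvits' capacity argument: differentiating the
     product of the linear forms of A successively in the variables keeps it nonzero on
     a half plane, hence real-rooted along positive lines, and AM-GM on the roots
     bounds the loss of capacity at each step. *)

Require Import Defs.
From HB Require Import structures.
From mathcomp Require Import all_boot all_order all_algebra.
From mathcomp Require Import all_fingroup all_field zify ring lra.
Set Implicit Arguments.
Unset Strict Implicit.
Unset Printing Implicit Defensive.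
Import Order.TTheory GRing.Theory Num.Theory.
Local Open Scope ring_scope.

(** * Mixed derivatives of a product of variables *)

Lemma setD1C (T : finType) (I : {set T}) i j : I :\ i :\ j = I :\ j :\ i.
Proof. by apply/setP=> x; rewrite !inE andbCA. Qed.

Lemma card_setD1S (T : finType) (I : {set T}) i m :
  i \in I -> (m < #|I|)%N = (m <= #|I :\ i|)%N.
Proof. by move=> iI; rewrite (cardsD1 i I) iI. Qed.

Lemma card_setD1_eq (T : finType) (I : {set T}) i m :
  i \in I -> #|I| = m.+1 -> #|I :\ i| = m.
Proof. by move=> iI; rewrite (cardsD1 i I) iI add1n => -[]. Qed.

Section Mixed.
Variables (T : finType) (J : Type).

(* The product of the [z i], [i \in I], differentiated along the vectors [a j],
   [j <- s]; when [#|I| = size s], the permanent of the matrix with columns [a j],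
   whatever [z]. *)
Fixpoint mixed (R : comNzRingType) (a : J -> T -> R) (z : T -> R) (s : seq J)
    (I : {set T}) : R :=
  if s is j :: s' then \sum_(i in I) a j i * mixed a z s' (I :\ i)
  else \prod_(i in I) z i.

Definition update (R : Type) (z : T -> R) i (w : R) : T -> R :=
  fun j => if j == i then w else z j.

Section Algebra.
Variables (R : comNzRingType) (a : J -> T -> R).

Lemma eq_mixed (z z' : T -> R) s (I : {set T}) : {in I, z =1 z'} -> mixed a z s I = mixed a z' s I.
Proof.
elim: s I => [|j s IHs] I eqz /=; first exact: eq_bigr.
apply: eq_bigr => i iI; congr (_ * _); apply: IHs => l.
by rewrite inE => /andP[_ /eqz].
Qed.

(** The form is affine in each variable: its slope in [z i] is the partial derivative, which just
    drops [i] from [I]. *)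
Lemma mixed_affine z i w s (I : {set T}) : i \in I ->
  mixed a (update z i w) s I
  = mixed a (update z i 0) s I + w * mixed a z s (I :\ i).
Proof.
elim: s I => [|j s IHs] I iI /=.
  rewrite !(big_setD1 i iI) /= /update eqxx mul0r add0r; congr (_ * _).
  by apply: eq_bigr => l; rewrite !inE => /andP[/negPf-> _].
rewrite !(big_setD1 i iI) /= -addrA; congr (_ + _).
  by congr (_ * _); apply: eq_mixed => l; rewrite !inE /update => /andP[/negPf->].
rewrite mulr_sumr -big_split /=; apply: eq_bigr => l.
rewrite !inE => /andP[neq lI]; rewrite IHs; last by rewrite !inE eq_sym neq.
by rewrite setD1C mulrDr mulrCA.
Qed.

Lemma mixed_swap z j k s I : mixed a z (j :: k :: s) I = mixed a z (k :: j :: s) I.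
Proof.
rewrite /=; under eq_bigr do rewrite mulr_sumr.
under [RHS]eq_bigr do rewrite mulr_sumr.
rewrite (exchange_big_dep (fun i => i \in I)) /=; last first.
  by move=> i l _; rewrite inE => /andP[].
apply: eq_bigr => l lI; apply: eq_big => [i|i _].
  by rewrite !inE lI andbT eq_sym andbC.
by rewrite mulrCA setD1C.
Qed.

(** With one index more than derivatives the form is linear in [z], so its value at [a k] is its
    derivative along [a k]; that derivative is constant, whence the arbitrary [w]. *)
Lemma mixed_linear w k s (I : {set T}) : #|I| = (size s).+1 ->
  mixed a (a k) s I = mixed a w (k :: s) I.
Proof.
elim: s I => [|j s IHs] I /= cardI.
  have /cards1P[i ->] : #|I| == 1%N by rewrite cardI.
  by rewrite !big_set1 setDv big_set0 mulr1.
rewrite -[RHS]/(mixed a w (k :: j :: s) I) mixed_swap /=.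
by apply: eq_bigr => i iI; rewrite (IHs _ (card_setD1_eq iI cardI)).
Qed.

Lemma deriv_prod_set (p : T -> {poly R}) (I : {set T}) :
  (\prod_(i in I) p i)^`() = \sum_(i in I) (p i)^`() * \prod_(j in I :\ i) p j.
Proof.
elim: {I}#|I| {-2}I (erefl #|I|) => [|m IHm] I cardI.
  by rewrite (cards0_eq cardI) !big_set0 derivC.
have /card_gt0P[i iI] : (0 < #|I|)%N by rewrite cardI.
rewrite (big_setD1 i iI) derivM /= (IHm _ (card_setD1_eq iI cardI)).
rewrite [RHS](big_setD1 i iI) /=; congr (_ + _); rewrite mulr_sumr.
apply: eq_bigr => j; rewrite !inE => /andP[neq jI].
rewrite [in RHS](big_setD1 i) ?inE 1?eq_sym ?neq //= mulrCA; congr (_ * (_ * _)).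
by rewrite setD1C.
Qed.

End Algebra.

Section Poly.
Variables (R : comNzRingType) (a : J -> T -> R).

(** The restriction of the form to the line [y + t * a k], as a polynomial in [t]; differentiating
    it adds [k] to the list of derivatives. *)
Definition mixed_poly (y : T -> R) (k : J) : seq J -> {set T} -> {poly R} :=
  mixed (fun j i => (a j i)%:P) (fun i => (y i)%:P + a k i *: 'X).

Lemma horner_mixed (aP : J -> T -> {poly R}) (zP : T -> {poly R}) z s I t :
    (forall j i, (aP j i).[t] = a j i) -> (forall i, (zP i).[t] = z i) ->
  (mixed aP zP s I).[t] = mixed a z s I.
Proof.
move=> aE zE; elim: s I => [|j s IHs] I /=.
  by rewrite horner_prod; apply: eq_bigr => i _.
by rewrite horner_sum; apply: eq_bigr => i _; rewrite hornerM aE IHs.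
Qed.

Lemma horner_mixed_poly y k s I t :
  (mixed_poly y k s I).[t] = mixed a (fun i => y i + t * a k i) s I.
Proof. by apply: horner_mixed => *; rewrite !hornerE // mulrC. Qed.

Lemma deriv_mixed_poly y k s I :
  (mixed_poly y k s I)^`() = mixed_poly y k (k :: s) I.
Proof.
elim: s I => [|j s IHs] I.
  rewrite /mixed_poly /= deriv_prod_set; apply: eq_bigr => i _; congr (_ * _).
  by rewrite derivD derivC derivZ derivX add0r alg_polyC.
rewrite /mixed_poly mixed_swap /= raddf_sum; apply: eq_bigr => i _ /=.
by rewrite derivM derivC mul0r add0r; congr (_ * _); exact: IHs.
Qed.

Lemma size_mixed_poly y k s (I : {set T}) m : #|I| = (m + size s)%N ->
  (size (mixed_poly y k s I) <= m.+1)%N.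
Proof.
rewrite /mixed_poly; elim: s I => [|j s IHs] I /=.
  rewrite addn0 => <-.
  rewrite -sum1_card -[X in (_ <= X.+1)%N]addn0.
  apply: (big_ind2 (fun (p : {poly R}) d => (size p <= (d + 0).+1)%N)).
  - by rewrite size_poly1.
  - move=> p d q e; rewrite !addn0 => lep leq'.
    apply: leq_trans (size_polyMleq _ _) _.
    lia.
  - move=> i _; apply: leq_trans (size_polyD _ _) _.
    rewrite geq_max (leq_trans (size_polyC_leq1 _)) //=.
    by rewrite (leq_trans (size_scale_leq _ _)) // size_polyX.
rewrite addnS => cardI.
apply: (big_ind (fun p : {poly R} => (size p <= m.+1)%N)).
- by rewrite size_poly0.
- by move=> p q lep leq'; rewrite (leq_trans (size_polyD _ _)) // geq_max lep.
- move=> i iI; rewrite mul_polyC (leq_trans (size_scale_leq _ _)) //.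
  exact: IHs (card_setD1_eq iI cardI).
Qed.

End Poly.
End Mixed.

(** * Stability and real-rootedness *)

Lemma sumr_set_gt0 (R : numDomainType) (T : finType) (I : {set T}) (F : T -> R) :
  (0 < #|I|)%N -> (forall i, i \in I -> 0 < F i) -> 0 < \sum_(i in I) F i.
Proof.
case/card_gt0P=> i iI F_gt0; rewrite (big_setD1 i iI) /=.
by rewrite ltr_pwDl ?F_gt0 ?sumr_ge0 // => j; rewrite inE => /andP[_ /F_gt0/ltW].
Qed.

Lemma mixed_ge0 (R : numDomainType) (T : finType) J (a : J -> T -> R) z s (I : {set T}) :
  (forall j i, 0 <= a j i) -> (forall i, 0 <= z i) -> 0 <= mixed a z s I.
Proof.
move=> a_ge0 z_ge0; elim: s I => [|j s IHs] I /=; first exact: prodr_ge0.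
by apply: sumr_ge0 => i _; rewrite mulr_ge0.
Qed.

Section HalfPlane.
Variables (C : numClosedFieldType) (T : finType) (J : Type) (a : J -> T -> C).
Hypothesis a_gt0 : forall j i, 0 < a j i.

Lemma mixed_gt0 z s (I : {set T}) :
  (size s <= #|I|)%N -> (forall i, 0 < z i) -> 0 < mixed a z s I.
Proof.
move=> sI z_gt0; elim: s I sI => [|j s IHs] I /= sI; first exact: prodr_gt0.
apply: sumr_set_gt0 => [|i iI]; first by apply: leq_trans sI.
by rewrite mulr_gt0 // IHs // -card_setD1S.
Qed.

(* Writing [F = mixed a z s I] and [F_i] for its partial derivatives, which are
   nonzero by induction, affineness of [F] in each [z i] puts [u * F / F_i] in the
   open upper half plane, so a positive combination of the [F_i / (u * F)] has
   negative imaginary part. *)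
Lemma mixed_neq0 u z s (I : {set T}) :
    (size s <= #|I|)%N -> (forall i, i \in I -> 0 < 'Im (u * z i)) ->
  mixed a z s I != 0.
Proof.
elim: s z I => [|j s IHs] z I /= sI z_half.
  apply/prodf_neq0 => i /z_half; apply: contraTneq => ->.
  by rewrite mulr0 (Creal_ImP _ _) ?real0 ?ltxx.
have Fneq0 : mixed a z s I != 0 by apply: IHs => //; apply: ltnW.
have Dneq0 i : i \in I -> mixed a z s (I :\ i) != 0.
  move=> iI; apply: IHs => [|l]; first by rewrite -card_setD1S.
  by rewrite inE => /andP[_ /z_half].
have u_neq0 : u != 0.
  have /card_gt0P[i /z_half] : (0 < #|I|)%N by apply: leq_trans sI.
  by apply: contraTneq => ->; rewrite mul0r (Creal_ImP _ _) ?real0 ?ltxx.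
have ImF i : i \in I -> 0 < 'Im (u * mixed a z s I / mixed a z s (I :\ i)).
  move=> iI; set B := mixed a z s (I :\ i).
  have Bneq0 : B != 0 by apply: Dneq0.
  pose A := mixed a (update z i 0) s I.
  have -> : mixed a z s I = A + z i * B.
    rewrite -mixed_affine //; apply: eq_mixed => l _.
    by rewrite /update; case: eqP => // ->.
  have -> : u * (A + z i * B) / B = u * z i - u * (- A / B).
    by rewrite mulrDr; field.
  rewrite raddfB /= subr_gt0; apply: le_lt_trans (z_half i iI).
  rewrite real_leNgt ?real0 ?Creal_Im //; apply/negP => root_half.
  (* [- A / B] is the zero of the form in the variable [z i]; in the half plane it would contradict
     the induction hypothesis. *)
  have /negP[] : mixed a (update z i (- A / B)) s I != 0.
    apply: IHs => [|l lI]; first exact: ltnW.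
    by rewrite /update; case: eqP => // _; apply: z_half.
  rewrite mixed_affine // -/A -/B; apply/eqP; field.
  by [].
have ImD i : i \in I -> 0 < - 'Im (mixed a z s (I :\ i) / (u * mixed a z s I)).
  move=> iI; rewrite -invf_div ImV mulNr opprK divr_gt0 ?ImF //.
  by rewrite exprn_gt0 // normr_gt0 !mulf_neq0 ?invr_eq0 ?Dneq0.
suff : 0 < - 'Im ((\sum_(i in I) a j i * mixed a z s (I :\ i)) / (u * mixed a z s I)).
  by apply: contraTneq => ->; rewrite mul0r (Creal_ImP _ _) ?real0 ?oppr0 ?ltxx.
rewrite mulr_suml raddf_sum /= -sumrN; apply: sumr_set_gt0 => [|i iI].
  by apply: leq_trans sI.
rewrite -mulrA ImMl ?gtr0_real //=.
by rewrite -mulrN mulr_gt0 ?ImD.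
Qed.

(** At a non-real [r] all the [y i + r * a k i] lie in one open half plane ([u = 1] or [u = -1]),
    where the form cannot vanish; at a real [r >= 0] the form is positive. *)
Lemma root_mixed_poly_lt0 y k s (I : {set T}) r :
    (size s <= #|I|)%N -> (forall i, 0 < y i) ->
  root (mixed_poly a y k s I) r -> r < 0.
Proof.
move=> sI y_gt0; rewrite /root horner_mixed_poly => Fr0.
have Im_shift (u : C) i : u \is Num.real ->
    'Im (u * (y i + r * a k i)) = u * 'Im r * a k i.
  move=> uR; rewrite ImMl // raddfD /= (Creal_ImP _ _) ?gtr0_real // add0r.
  by rewrite ImMr ?gtr0_real //= mulrA.
have r_real : r \is Num.real.
  apply/Creal_ImP; case: (real_ltgt0P (Creal_Im r)) => // Im_r.
    apply: contraTeq Fr0 => _; apply: (@mixed_neq0 1) => // i _.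
    by rewrite Im_shift ?real1 // mul1r mulr_gt0.
  apply: contraTeq Fr0 => _; apply: (@mixed_neq0 (-1)) => // i _.
  by rewrite Im_shift ?rpredN ?real1 // mulN1r mulr_gt0 // oppr_gt0.
rewrite real_ltNge ?real0 //; apply/negP => r_ge0.
have := @mixed_gt0 (fun i => y i + r * a k i) s I sI _.
rewrite (eqP Fr0) ltxx => gt0F.
suff: false by []; apply: gt0F => i.
by rewrite ltr_pwDl // mulr_ge0 // ltW.
Qed.
End HalfPlane.

Section RealRooted.
Variable C : numClosedFieldType.

(** AM-GM for the numbers [1 + x]; padding [s] with zeros to length [m.+1] changes neither side. *)
Lemma AGM_seq (s : seq C) m : (size s <= m.+1)%N -> {in s, forall x, 0 <= x} ->
  \prod_(x <- s) (1 + x) <= (1 + (\sum_(x <- s) x) / m.+1%:R) ^+ m.+1.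
Proof.
move=> sm s_ge0.
have nth_ge0 (i : nat) : 0 <= nth 0 s i.
  by have [/(mem_nth 0)/s_ge0 //|/(nth_default 0)->] := ltnP i (size s).
have -> : \prod_(x <- s) (1 + x) = \prod_(i < m.+1) (1 + nth 0 s i).
  rewrite (big_nth 0) big_mkord (big_ord_widen _ (fun i => 1 + nth 0 s i) sm).
  rewrite big_mkcond; apply: eq_bigr => i _; case: ifPn => //.
  by rewrite -leqNgt => /(nth_default 0)->; rewrite addr0.
have -> : \sum_(x <- s) x = \sum_(i < m.+1) nth 0 s i.
  rewrite (big_nth 0) big_mkord (big_ord_widen _ (fun i => nth 0 s i) sm).
  rewrite big_mkcond; apply: eq_bigr => i _; case: ifPn => //.
  by rewrite -leqNgt => /(nth_default 0)->.
have [] := @leif_AGM C 'I_m.+1 predT (fun i => 1 + nth 0 s i) _.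
  by move=> i _; rewrite addr_ge0.
rewrite card_ord big_split /= sumr_const card_ord => + _; congr (_ <= _ ^+ _).
by rewrite mulrDl divff // pnatr_eq0.
Qed.

(** Up to the factor [p.[0]], [p] is the product of the [1 + b * 'X] with [b = - r^-1 > 0], [r]
    running over the roots. The [b] add up to the logarithmic derivative of [p] at 0, and AM-GM
    bounds the product. *)
Lemma real_rooted_le (p : {poly C}) m t :
    (size p <= m.+2)%N -> 0 < p.[0] -> (forall r, root p r -> r < 0) -> 0 <= t ->
  p.[t] <= p.[0] * (1 + t * (p^`().[0] / p.[0]) / m.+1%:R) ^+ m.+1.
Proof.
move=> size_p p0_gt0 roots_lt0 t_ge0.
have p_neq0 : p != 0 by apply: contraTneq p0_gt0 => ->; rewrite horner0 ltxx.
have [rs def_p] := closed_field_poly_normal p.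
have rs_lt0 : {in rs, forall r, r < 0}.
  move=> r r_rs; apply: roots_lt0; rewrite def_p rootZ ?lead_coef_eq0 //.
  by rewrite root_prod_XsubC.
pose bs := [seq - r^-1 | r <- rs].
have bs_gt0 : {in bs, forall b, 0 < b}.
  by move=> b /mapP[r /rs_lt0 r_lt0 ->]; rewrite oppr_gt0 invr_lt0.
have [c def_c] : exists c, p = c *: \prod_(b <- bs) (1 + b *: 'X).
  exists (lead_coef p * \prod_(r <- rs) - r); rewrite {1}def_p -scalerA; congr (_ *: _).
  rewrite big_map -scaler_prod; apply: eq_big_seq => r /rs_lt0 r_lt0.
  rewrite scalerDr scalerA mulrNN divff ?lt_eqF // scale1r alg_polyC polyCN.
  by rewrite addrC.
have deriv_bs (s : seq C) : (\prod_(b <- s) (1 + b *: 'X)).[0] = 1 /\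
    (\prod_(b <- s) (1 + b *: 'X))^`().[0] = \sum_(b <- s) b.
  elim: s => [|b s [IH0 IH1]]; first by rewrite !big_nil derivC !hornerE.
  rewrite !big_cons derivM !hornerE IH0 IH1 !derivE !hornerE.
  by split; ring.
have [prod0 prod1] := deriv_bs bs.
have c_p0 : c = p.[0] by rewrite def_c hornerZ prod0 mulr1.
have -> : p^`().[0] / p.[0] = \sum_(b <- bs) b.
  by rewrite -c_p0 {1}def_c derivZ hornerZ prod1 mulrC mulKf // c_p0 gt_eqF.
rewrite {1}def_c hornerZ c_p0 ler_pM2l // horner_prod mulr_sumr.
rewrite -(big_map (fun b => t * b) xpredT id) /=.
rewrite (eq_bigr (fun b => 1 + t * b)); last first.
  by move=> b _; rewrite !hornerE mulrC.
rewrite -(big_map (fun b => t * b) xpredT (fun x => 1 + x)) /=.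
apply: AGM_seq => [|x /mapP[b /bs_gt0 b_gt0 ->]]; last by rewrite mulr_ge0 // ltW.
rewrite !size_map -ltnS; apply: leq_trans size_p.
by rewrite def_p size_scale ?lead_coef_eq0 // size_prod_XsubC.
Qed.
End RealRooted.

(** * Van der Waerden's bound for regular 0/1 matrices *)

Section Capacity.
Variables (C : numClosedFieldType) (T : finType) (a : nat -> T -> C).
Hypothesis a_gt0 : forall j i, 0 < a j i.

(* With [D] the right-hand side and [p] the polynomial [mixed_poly a y k s I], the
   bound is [cap] at the minimizer [t] of [p.[0] * (1 + t * (D / p.[0]) / m.+2) ^+ m.+2 / t]. *)
Lemma capacity_step (y : T -> C) k s (I : {set T}) m (L : C) :
    #|I| = (m.+2 + size s)%N -> (forall i, 0 < y i) ->
    (forall t, 0 < t -> L * t <= mixed a (fun i => y i + t * a k i) s I) ->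
  L * (m.+1%:R / m.+2%:R) ^+ m.+1 <= mixed a y (k :: s) I.
Proof.
move=> cardI y_gt0 cap; set D := mixed a y _ I.
have sI : (size s <= #|I|)%N by rewrite cardI leq_addl.
have D_gt0 : 0 < D by apply: mixed_gt0 => //=; rewrite cardI !addSn ltnS leqW // leq_addl.
pose p := mixed_poly a y k s I.
have eval0 l : (mixed_poly a y k l I).[0] = mixed a y l I.
  by rewrite horner_mixed_poly; apply: eq_mixed => i _; rewrite mul0r addr0.
have p0_gt0 : 0 < p.[0] by rewrite eval0 mixed_gt0.
have m1_gt0 : 0 < m.+1%:R :> C by rewrite ltr0n.
have m2_gt0 : 0 < m.+2%:R :> C by rewrite ltr0n.
have dp0 : p^`().[0] = D by rewrite deriv_mixed_poly eval0.
pose t := m.+2%:R * p.[0] / (m.+1%:R * D).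
have t_gt0 : 0 < t by rewrite divr_gt0 ?mulr_gt0.
have root_lt0 r : root p r -> r < 0 by apply: root_mixed_poly_lt0.
have := real_rooted_le (size_mixed_poly a y k cardI) p0_gt0 root_lt0 (ltW t_gt0).
rewrite horner_mixed_poly dp0 => /(le_trans (cap t t_gt0)) {}cap.
set g := m.+2%:R / m.+1%:R : C.
have g_gt0 : 0 < g by rewrite divr_gt0.
(* At this [t] the bound is [p.[0] * g ^+ m.+2]; dividing it by [t = p.[0] * g / D] leaves
   [D * g ^+ m.+1]. *)
have def_g : 1 + t * (D / p.[0]) / m.+2%:R = g.
  have m2E : m.+2%:R = m.+1%:R + 1 :> C by rewrite natr1.
  rewrite /t /g; move: m1_gt0 m2_gt0; rewrite m2E; move: (m.+1%:R) => M *; field.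
  by rewrite !gt_eqF.
rewrite def_g in cap.
rewrite -invf_div -/g exprVn ler_pdivrMr ?exprn_gt0 //.
have def_t : t = p.[0] * g / D 
  by rewrite /t /g; move: m1_gt0 m2_gt0; move: (m.+1%:R) (m.+2%:R) => M M' *; field; rewrite !gt_eqF.
rewrite -(ler_pM2r t_gt0); apply: le_trans cap _.
rewrite le_eqVlt; apply/orP; left; apply/eqP; rewrite def_t exprS; field.
by rewrite gt_eqF.
Qed.

(** Gurvits' induction: the variables are removed from the last to the first, each by one
    derivative, and the losses of [capacity_step] telescope. *)
Lemma capacity_le_mixed n (L : C) w : #|T| = n.+1 ->
    (forall x : nat -> C, (forall j, 0 < x j) ->
       L * \prod_(j < n.+1) x j
       <= mixed a (fun i => \sum_(j < n.+1) x j * a j i) [::] [set: T]) ->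
  L * (n.+1`!%:R / n.+1%:R ^+ n.+1) <= mixed a w (iota 0 n.+1) [set: T].
Proof.
move=> cardT cap.
(* [c k] is the loss accumulated after [n - k] derivatives: [c n = 1], and [c k / c k.+1] is the
   loss of a single step. *)
pose c k : C := n.+1`!%:R / n.+1%:R ^+ n.+1 * (k.+1%:R ^+ k.+1 / k.+1`!%:R).
have fact_neq0 m : m`!%:R != 0 :> C by rewrite pnatr_eq0 -lt0n fact_gt0.
suff partial d k : (k + d = n)%N -> forall x : nat -> C, (forall j, 0 < x j) ->
    L * c k * \prod_(j < k.+1) x j
    <= mixed a (fun i => \sum_(j < k.+1) x j * a j i) (iota k.+1 d) [set: T].
  have := partial n 0%N (add0n n) (fun=> 1) (fun=> ltr01).
  rewrite big1 // mulr1 /c expr1 divr1 mulr1 => /le_trans; apply.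
  (* Only [x 0] is left, and the value at [a 0] of a linear form is the last derivative. *)
  rewrite (_ : iota 0 n.+1 = 0%N :: iota 1 n) // -mixed_linear; last first.
    by rewrite cardsT cardT size_iota.
  by rewrite le_eqVlt; apply/orP; left; apply/eqP/eq_mixed => i _; rewrite big_ord1 mul1r.
elim: d k => [|d IHd] k kd x x_gt0.
  move: kd; rewrite addn0 => kn; subst k; apply: le_trans (cap x x_gt0).
  by rewrite /c mulrA divfK ?expf_neq0 ?pnatr_eq0 // mulfV // mulr1.
have {}kd : (k.+1 + d = n)%N by rewrite addSnnS.
rewrite (_ : iota _ _ = k.+1 :: iota k.+2 d) //.
have := @capacity_step (fun i => \sum_(j < k.+1) x j * a j i) k.+1 (iota k.+2 d)
  [set: T] k (L * c k.+1 * \prod_(j < k.+1) x j) _ _ _.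
have -> : L * c k.+1 * (\prod_(j < k.+1) x j) * (k.+1%:R / k.+2%:R) ^+ k.+1
    = L * c k * \prod_(j < k.+1) x j.
  rewrite mulrAC -[L * c k.+1 * _]mulrA; congr (L * _ * _).
  rewrite /c -[LHS]mulrA; congr (_ * _).
  rewrite (factS k.+1) natrM exprMn exprVn (exprS k.+2%:R); field.
  by rewrite expf_neq0 ?fact_neq0 -?natrD ?pnatr_eq0.
apply.
- by rewrite cardsT cardT size_iota -kd; lia.
- move=> i; rewrite big_ord_recl ltr_pwDl ?mulr_gt0 ?sumr_ge0 // => j _.
  by rewrite ltW ?mulr_gt0.
move=> t t_gt0.
pose x' j := if j == k.+1 then t else x j.
have x'_gt0 j : 0 < x' j by rewrite /x'; case: ifP.
have x'E (j : 'I_k.+1) : x' j = x j by rewrite /x' ltn_eqF.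
have := IHd k.+1 kd x' x'_gt0.
rewrite big_ord_recr /= (eq_bigr (fun j : 'I_k.+1 => x j)) // {1}/x' eqxx mulrA => /le_trans; apply.
rewrite le_eqVlt; apply/orP; left; apply/eqP/eq_mixed => i _.
rewrite big_ord_recr /= {2}/x' eqxx; congr (_ + _).
by apply: eq_bigr => j _; rewrite x'E.
Qed.

End Capacity.

(** AM-GM over the [r] ones of each row; in the product over the rows each [x j] occurs [r] times,
    so the inequality is proved between [r]-th powers. *)
Lemma prod_row_sums_ge (C : numClosedFieldType) (n r : nat) (T : finType)
    (B : nat -> T -> bool) (x : nat -> C) :
    #|T| = n -> (0 < r)%N -> (forall j, 0 < x j) ->
    (forall j, (j < n)%N -> #|[set i | B j i]| = r) ->
    (forall i, #|[set j : 'I_n | B j i]| = r) ->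
  r%:R ^+ n * \prod_(j < n) x j <= \prod_(i : T) \sum_(j < n) x j * (B j i)%:R.
Proof.
move=> cardT r_gt0 x_gt0 colB rowB.
have r0 : 0 < r%:R :> C by rewrite ltr0n.
have sum_ge0 i : 0 <= \sum_(j < n) x j * (B j i)%:R.
  by apply: sumr_ge0 => j _; rewrite mulr_ge0 ?ler0n ?ltW.
rewrite -(@ler_pXn2r _ r) // ?nnegrE ?prodr_ge0 //; last first.
  by rewrite mulr_ge0 ?exprn_ge0 ?ler0n // prodr_ge0 // => j _; rewrite ltW.
have AGM i : r%:R ^+ r * \prod_(j < n | B j i) x j <= (\sum_(j < n) x j * (B j i)%:R) ^+ r.
  have inB (j : 'I_n) : (j \in [set j : 'I_n | B j i]) = B j i by rewrite inE.
  have [] := @leif_AGM C 'I_n [set j : 'I_n | B j i] (fun j => x j) _.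
    by move=> j _; rewrite ltW.
  rewrite rowB => + _; rewrite expr_div_n ler_pdivlMr ?exprn_gt0 // mulrC.
  rewrite !(eq_bigl _ _ inB); move/le_trans; apply; rewrite le_eqVlt; apply/orP; left; apply/eqP; congr (_ ^+ _).
  rewrite [RHS](bigID (fun j : 'I_n => B j i)) /= [X in _ + X]big1 ?addr0 => [|j /negPf->]; last by rewrite mulr0.
  by apply: eq_bigr => j ->; rewrite mulr1.
rewrite -prodrXl; apply: le_trans (_ : _ <= \prod_(i : T) (r%:R ^+ r * \prod_(j < n | B j i) x j)) _.
  rewrite big_split /= prodr_const cardT exprMn -!exprM mulnC.
  rewrite ler_pM2l ?exprn_gt0 //.
  rewrite (exchange_big_dep xpredT) //= -prodrXl le_eqVlt; apply/orP; left; apply/eqP.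
  by apply: eq_bigr => j _; rewrite prodr_const -(colB j) // cardsE.
apply: ler_prod => i _; rewrite AGM mulr_ge0 ?exprn_ge0 ?ler0n //.
by apply: prodr_ge0 => j _; rewrite ltW.
Qed.

(** Right continuity at 0: [p - p.[0]] is divisible by ['X], with a quotient bounded on the unit
    interval. It carries bounds from positive matrices to 0/1 matrices. *)
Lemma poly_le_near0 (C : numFieldType) (p : {poly C}) c :
    c \is Num.real -> p.[0] \is Num.real ->
    (forall e, 0 < e -> c <= p.[e]) ->
  c <= p.[0].
Proof.
move=> cR p0R cp.
have [q def_q] : exists q, p = q * 'X + p.[0]%:P.
  have /factor_theorem[q] : root (p - p.[0]%:P) 0 by rewrite /root !hornerE subrr.
  by rewrite subr0 => def_q; exists q; rewrite -def_q subrK.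
pose K := \sum_(i < size q) `|q`_i|.
have K_ge0 : 0 <= K by apply: sumr_ge0.
have q_le e : 0 < e -> e <= 1 -> `|q.[e]| <= K.
  move=> e_gt0 e_le1; rewrite horner_coef (le_trans (ler_norm_sum _ _ _)) //.
  apply: ler_sum => i _; rewrite normrM normrX (gtr0_norm e_gt0).
  by rewrite ler_piMr // exprn_ile1 // ltW.
rewrite real_leNgt //; apply/negP => lt_pc.
pose d := c - p.[0]; have d_gt0 : 0 < d by rewrite subr_gt0.
have dK : 0 < d + K + 1 by rewrite ltr_wpDl // addr_ge0 // ltW.
(* Chosen so that [e <= 1] and [e * K < d]. *)
pose e := d / (d + K + 1).
have e_gt0 : 0 < e by rewrite divr_gt0.
have e_le1 : e <= 1 by rewrite ler_pdivrMr // mul1r -addrA lerDl addr_ge0.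
have := cp e e_gt0; rewrite {1}def_q hornerD hornerM hornerX hornerC -lerBlDr -/d.
move=> le_d; have : d <= e * K.
  rewrite -(ger0_norm (ltW d_gt0)).
  have /le_trans-> // : `|d| <= `|q.[e] * e|.
    by rewrite !ger0_norm // ?(le_trans (ltW d_gt0) le_d) // ltW.
  by rewrite normrM (gtr0_norm e_gt0) mulrC ler_pM2l // q_le.
rewrite /e mulrAC ler_pdivlMr // ler_pM2l // addrAC gerDr.
by rewrite lt_geF // addr_gt0.
Qed.

(** * Permanents of 0/1 matrices as numbers of transversals *)

Section Rows.
Variables (T : finType) (J : Type) (B : J -> T -> bool).

(** The recursion copies that of [mixed], so that the number of lists is the permanent of [B] when
    [#|I| = size s]. *)
Fixpoint rows (s : seq J) (I : {set T}) : seq (seq T) :=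
  if s is j :: s' then
    [seq i :: l | i <- enum [set i in I | B j i], l <- rows s' (I :\ i)]
  else [:: [::]].

Lemma size_rows (R : comNzRingType) (w : T -> R) s (I : {set T}) : #|I| = size s ->
  (size (rows s I))%:R = mixed (fun j i => (B j i)%:R) w s I.
Proof.
elim: s I => [|j s IHs] I /= cardI.
  by rewrite (cards0_eq cardI) big_set0.
rewrite size_allpairs_dep sumnE big_map big_enum natr_sum /=.
rewrite (eq_bigl (fun i => (i \in I) && B j i)) => [|i]; last by rewrite inE.
rewrite big_mkcondr; apply: eq_bigr => i iI.
rewrite (IHs _ (card_setD1_eq iI cardI)).
by case: (B j i); rewrite ?mul1r ?mul0r.
Qed.

Lemma uniq_rows s I : uniq (rows s I).
Proof.
elim: s I => [|j s IHs] I //=.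
by apply: allpairs_uniq_dep => [|i _|[i l] [i' l'] _ _ /= [-> ->]] //; apply: enum_uniq.
Qed.

Lemma rowsP j0 x0 s (I : {set T}) l : l \in rows s I ->
  [/\ size l = size s, uniq l, {subset l <= I}
    & forall k, (k < size s)%N -> B (nth j0 s k) (nth x0 l k)].
Proof.
elim: s I l => [|j s IHs] I l /=; first by rewrite inE => /eqP->.
case/allpairsPdep=> i [l' [/[!mem_enum] /[!inE] /andP[iI Bji] /IHs[<- uniq_l' sub_l' B_l'] ->]].
split=> //= [|x|[|k]//].
- by rewrite uniq_l' andbT; apply/negP => /sub_l'; rewrite !inE eqxx.
- by rewrite inE => /predU1P[->|/sub_l'] //; rewrite inE => /andP[].
- by rewrite ltnS; apply: B_l'.
Qed.
End Rows.

Section Transversals.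
Variable n : nat.
Implicit Type B : 'I_n.+1 -> 'I_n.+1 -> bool.

Definition transversals B : {set {ffun 'I_n.+1 -> 'I_n.+1}} :=
  [set f : {ffun _ -> _} | injectiveb f & [forall j, B j (f j)]].

Lemma size_rows_le B :
  (size (rows (fun j => B (inord j)) (iota 0 n.+1) [set: 'I_n.+1])
   <= #|transversals B|)%N.
Proof.
set rs := rows _ _ _; pose g (l : seq 'I_n.+1) := [ffun j : 'I_n.+1 => nth ord0 l j].
have rsP l : l \in rs -> _ := @rowsP _ _ _ 0%N ord0 _ _ l.
rewrite -(size_map g) cardE; apply: uniq_leq_size => [|f /mapP[l /rsP[]]].
  rewrite map_inj_in_uniq ?uniq_rows // => l l' /rsP[sz _ _ _] /rsP[sz' _ _ _].
  move=> /ffunP eq_g; apply: (@eq_from_nth _ ord0) => [|i]; first by rewrite sz sz'.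
  by rewrite sz size_iota => lt_i; have := eq_g (Ordinal lt_i); rewrite !ffunE.
rewrite size_iota => sz uniq_l _ B_l ->; rewrite mem_enum inE; apply/andP; split.
  apply/injectiveP => i j; rewrite !ffunE => /eqP; rewrite nth_uniq ?sz //.
  by move/eqP/val_inj.
apply/forallP => j; rewrite ffunE; have := B_l j (ltn_ord j).
by rewrite nth_iota // add0n inord_val.
Qed.

(** Van der Waerden's bound for an [r]-regular 0/1 matrix. The capacity argument needs positive
    entries, so it is run on [B + e], whose permanent is a polynomial in [e], and [e] goes to 0. *)
Lemma card_transversals_ge B r :
    (forall j, #|[set i | B j i]| = r) -> (forall i, #|[set j | B j i]| = r) ->
  (r ^ n.+1 * n.+1`! <= #|transversals B| * n.+1 ^ n.+1)%N.
Proof.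
move=> colB rowB; apply: leq_trans (leq_mul (size_rows_le B) (leqnn _)).
have [->|r_gt0] := posnP r; first by rewrite exp0n.
pose B' j := B (inord j).
have inB' (j : 'I_n.+1) : B' j = B j by rewrite /B' inord_val.
have colB' j : (j < n.+1)%N -> #|[set i | B' j i]| = r by rewrite colB.
have rowB' i : #|[set j : 'I_n.+1 | B' j i]| = r.
  by rewrite -(rowB i); apply: eq_card => j; rewrite !inE inB'.
rewrite -(ler_nat algC) natrM [X in _ <= X]natrM !natrX -ler_pdivrMr ?exprn_gt0 ?ltr0n //.
rewrite (size_rows _ (fun=> 1)); last by rewrite cardsT card_ord size_iota.
pose p : {poly algC} := mixed (fun j i => (B' j i)%:R%:P + 'X) (fun=> 1%:P)
  (iota 0 n.+1) [set: 'I_n.+1].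
have pE e : p.[e] = mixed (fun j i => (B' j i)%:R + e) (fun=> 1)
    (iota 0 n.+1) [set: 'I_n.+1].
  by apply: horner_mixed => *; rewrite !hornerE.
have p0E : p.[0] = mixed (fun j i => (B' j i)%:R) (fun=> 1) (iota 0 n.+1) [set: 'I_n.+1].
  by apply: horner_mixed => *; rewrite !hornerE.
rewrite -p0E -mulrA; apply: poly_le_near0.
- by rewrite !rpredM ?rpredV ?rpredX ?realn // ger0_real ?ler0n ?invr_ge0 ?exprn_ge0 ?ler0n.
- by rewrite p0E ger0_real // mixed_ge0.
move=> e e_gt0; rewrite pE; apply: capacity_le_mixed => [j i||x x_gt0].
- by rewrite ltr_wpDl.
- by rewrite card_ord.
apply: le_trans (prod_row_sums_ge _ r_gt0 x_gt0 colB' rowB') _; first by rewrite card_ord.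
rewrite /= [leRHS](eq_bigl xpredT) => [|i]; last by rewrite inE.
apply: ler_prod => i _; rewrite sumr_ge0 => [|j _]; last by rewrite mulr_ge0 // ltW.
by apply: ler_sum => j _; rewrite ler_pM2l // lerDl ltW.
Qed.
End Transversals.

Local Close Scope ring_scope.

(** * Latin rectangles *)

Section LatinRectangles.
Variable n : nat.
Local Notation map_type := {ffun 'I_n.+1 -> 'I_n.+1}.

Definition latin_rectangles k : {set k.-tuple map_type} :=
  [set t : k.-tuple map_type | all (fun f : map_type => injectiveb f) t
     & [forall j, uniq [seq (f : map_type) j | f <- t]]].

(** The 0/1 matrix whose transversals are the rows that extend [t]. *)
Definition unused (t : seq map_type) (j i : 'I_n.+1) : bool :=
  i \notin [seq (f : map_type) j | f <- t].

Lemma cons_latin_rectangles k f (t : k.-tuple map_type) :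
  (cons_tuple f t \in latin_rectangles k.+1)
  = (t \in latin_rectangles k) && (f \in transversals (unused t)).
Proof.
rewrite !inE /= andbACA andbC [_ && all _ _]andbC andbC; congr (_ && _).
apply/forallP/andP => [uniq_t|[/forallP uniq_t /forallP unused_f] j]; last first.
  by rewrite uniq_t andbT; apply: unused_f.
by split; apply/forallP => j; have /andP[] := uniq_t j.
Qed.

Lemma card_latin_rectanglesS k :
  #|latin_rectangles k.+1| = \sum_(t in latin_rectangles k) #|transversals (unused t)|.
Proof.
rewrite -sum1_card (partition_big (fun t : k.+1.-tuple map_type => [tuple of behead t]) (mem (latin_rectangles k))) /=.
  apply: eq_bigr => t t_lat; rewrite sum1_card.
  rewrite -[RHS](card_imset _ (f := fun f : map_type => cons_tuple f t)); last first.
    by move=> f g /(congr1 (@thead _ _)).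
  apply: eq_card => u; case/tupleP: u => f u; rewrite unfold_in /=.
  have -> : [tuple of behead (cons_tuple f u)] = u by apply: val_inj.
  rewrite cons_latin_rectangles.
  apply/andP/imsetP => [[/andP[_ f_tr] /eqP<-]|[g g_tr]]; first by exists f.
  move=> eq_fu; have := congr1 (@thead _ _) eq_fu; rewrite !theadE => ->.
  have -> : u = t by apply: val_inj; have := congr1 val eq_fu => -[].
  by rewrite t_lat.
move=> t; case/tupleP: t => f u; rewrite cons_latin_rectangles => /andP[u_lat _].
by have -> : [tuple of behead (cons_tuple f u)] = u by apply: val_inj.
Qed.

(** A column has met [k] distinct symbols; a symbol occurs once in each of the [k] rows, in [k]
    different columns. *)
Lemma card_unused k (t : k.-tuple map_type) : t \in latin_rectangles k ->
  (forall j, #|[set i | unused t j i]| = n.+1 - k)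
  /\ (forall i, #|[set j | unused t j i]| = n.+1 - k).
Proof.
rewrite inE => /andP[/allP inj_t /forallP uniq_t]; split=> [j|i].
  rewrite (_ : [set i | _] = ~: [set i in [seq (f : map_type) j | f <- t]]).
    by rewrite cardsCs setCK card_ord cardsE (card_uniqP (uniq_t j)) size_map size_tuple.
  by apply/setP=> i; rewrite !inE.
rewrite (_ : [set j | _] = ~: [set j | i \in [seq (f : map_type) j | f <- t]]); last first.
  by apply/setP=> j; rewrite !inE.
rewrite cardsCs setCK card_ord; congr (_ - _).
rewrite -sum1_card big_mkcond /=.
(* Double counting of the pairs of a column [j] and a row [f] with [f j = i]; a column is in at most
   one such pair, its entries being distinct. *)
rewrite (eq_bigr (fun j => \sum_(f <- t) (f j == i))); last first.
  move=> j _; rewrite inE -(big_map (fun f : map_type => f j) xpredT (fun x => (x == i) : nat)).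
  rewrite (eq_bigr (fun x => if x == i then 1 else 0)); last by move=> x _; case: eqP.
  by rewrite -big_mkcond sum1_count (count_uniq_mem _ (uniq_t j)); case: ifP.
rewrite exchange_big /= -{2}(size_tuple t) -sum1_size.
apply: eq_big_seq => f /inj_t/injectiveP inj_f.
have [g _ gK] := injF_bij inj_f.
rewrite (bigD1 (g i)) //= gK eqxx big1 // => j; apply: contraNeq.
by rewrite eqb0 negbK => /eqP <-; rewrite -{1}(inj_f _ _ (gK (f j))).
Qed.

(** Van der Waerden's bound is multiplied over the rows; the degrees [n.+1 - k] build up the falling
    factorial. *)
Lemma card_latin_rectangles_ge k : k <= n.+1 ->
  n.+1`! ^ k * (n.+1 ^_ k) ^ n.+1 <= #|latin_rectangles k| * n.+1 ^ (n.+1 * k).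
Proof.
elim: k => [|k IHk] lt_kn.
  rewrite ffactn0 exp1n !expn0 muln0 expn0 !muln1 card_gt0; apply/set0Pn.
  by exists [tuple]; rewrite inE; apply/forallP.
rewrite card_latin_rectanglesS ffactnSr expnMn expnS mulnS expnD.
have step : #|latin_rectangles k| * ((n.+1 - k) ^ n.+1 * n.+1`!)
    <= (\sum_(t in latin_rectangles k) #|transversals (unused t)|) * n.+1 ^ n.+1.
  rewrite big_distrl -sum_nat_const; apply: leq_sum => t /card_unused[colB rowB].
  exact: card_transversals_ge.
have := leq_mul (IHk (ltnW lt_kn)) (leqnn ((n.+1 - k) ^ n.+1 * n.+1`!)).
have := leq_mul step (leqnn (n.+1 ^ (n.+1 * k))).
move=> le1 le2.
apply: leq_trans (_ : #|latin_rectangles k| * ((n.+1 - k) ^ n.+1 * n.+1`!) * n.+1 ^ (n.+1 * k) <= _).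
  by apply: leq_trans (leq_trans le2 _); rewrite leq_eqVlt; apply/orP; left; apply/eqP; ring.
by apply: leq_trans le1 _; rewrite leq_eqVlt; apply/orP; left; apply/eqP; ring.
Qed.

Definition table_of_rows (t : n.+1.-tuple map_type) : table n.+1 :=
  (\matrix_(i, j) tnth t i j)%R.

Lemma table_of_rows_inj : injective table_of_rows.
Proof.
move=> t u /matrixP eq_tu; apply: eq_from_tnth => i; apply/ffunP => j.
by have := eq_tu i j; rewrite !mxE.
Qed.

Lemma table_of_rows_latin t : t \in latin_rectangles n.+1 -> is_latin_square (table_of_rows t).
Proof.
rewrite inE => /andP[/all_tnthP inj_t /forallP uniq_t]; split=> [i|j].
  by apply: injF_bij => j k; rewrite !mxE => /(injectiveP _ (inj_t i)).
apply: injF_bij => i k; rewrite !mxE.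
have nthE l : tnth t l j = nth ord0 [seq (f : map_type) j | f <- t] l.
  by rewrite (nth_map (tnth t l)) ?size_tuple // -tnth_nth.
by rewrite !nthE => /eqP; rewrite nth_uniq ?size_map ?size_tuple // => /eqP/val_inj.
Qed.

End LatinRectangles.

(** * Terms of a DNF *)

Lemma term_eval_mix V (t : term V) (x y h : V -> bool) :
    (forall v, h v = x v \/ h v = y v) ->
  term_eval t x -> term_eval t y -> term_eval t h.
Proof.
move=> mix; rewrite /term_eval; elim: t => //= l t IHt.
move=> /andP[/eqP xl /IHt{}IHt] /andP[/eqP yl /IHt->]; rewrite andbT.
by case: (mix l.1) => ->; apply/eqP.
Qed.

(** Each [x] in [S] is sent to the first term it satisfies. A term shared by two elements would
    accept their mix [h], so this map is injective. *)
Lemma num_terms_ge V (X : finType) (S : {set X}) (D : dnf V) (e : X -> V -> bool) :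
    {in S, forall x, dnf_eval D (e x)} ->
    {in S &, forall x y, x != y ->
       exists2 h, forall v, h v = e x v \/ h v = e y v & ~~ dnf_eval D h} ->
  #|S| <= num_terms D.
Proof.
move=> acceptS separateS.
pose idx x := find (fun t => term_eval t (e x)) D.
have idxS x : x \in S -> idx x < size D by move/acceptS; rewrite -has_find.
have evalS x : x \in S -> term_eval (nth [::] D (idx x)) (e x).
  by move/acceptS; apply: nth_find.
rewrite -(size_iota 0 (num_terms D)) cardE -(size_map idx).
apply: uniq_leq_size => [|_ /mapP[x + ->]]; last first.
  by rewrite mem_enum mem_iota => /idxS.
rewrite map_inj_in_uniq ?enum_uniq // => x y /[!mem_enum] xS yS eq_idx.
apply/eqP; apply: contraT => /(separateS x y xS yS)[h mix].
case/negP; rewrite /dnf_eval; apply/(has_nthP [::]); exists (idx x); first exact: idxS.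
by apply: term_eval_mix mix (evalS x xS) _; rewrite eq_idx evalS.
Qed.

(** * Hybrids of two tables *)

Definition hybrid n (A B : table n) i j : table n :=
  (\matrix_(k, l) if (k == i) && (l == j) then B k l else A k l)%R.

Lemma hybrid_mix n (enc : encoding n) (A B : table n) i j v :
  encode enc (hybrid A B i j) v = encode enc A v
  \/ encode enc (hybrid A B i j) v = encode enc B v.
Proof. by rewrite /encode mxE; case: ifP; [right | left]. Qed.

(** The value [B i j] already stands in row [i] of [A], in a column other than [j], so the hybrid
    has it twice in that row. *)
Lemma hybrid_not_latin n (A B : table n) i j :
  is_latin_square A -> A i j != B i j -> ~ is_latin_square (hybrid A B i j).
Proof.
move=> [rowA _] neq [/(_ i) /bij_inj inj_h _].
have [g _ gK] := rowA i; have eq_h : hybrid A B i j i (g (B i j)) = hybrid A B i j i j.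
  rewrite !mxE !eqxx /=; case: eqP => [->|_] //; exact: gK.
by case/eqP: neq; rewrite -[RHS]gK /= (inj_h _ _ eq_h).
Qed.

Lemma group_table_latin n (A : table n) : is_group_table A -> is_latin_square A.
Proof.
move=> [e [inv [assoc lid rid linv rinv]]]; rewrite /table_op in assoc lid rid linv rinv.
split=> [i|j].
  by exists (A (inv i)) => j; rewrite assoc ?linv ?rinv lid.
by exists (fun i => A i (inv j)) => i; rewrite -assoc ?linv ?rinv rid.
Qed.

Lemma neq_table n (A B : table n) : A != B -> exists i, exists j, A i j != B i j.
Proof.
case: (pickP (fun p : 'I_n * 'I_n => A p.1 p.2 != B p.1 p.2)) => [[i j] neq _|eqAB].
  by exists i, j.
by case/eqP; apply/matrixP => i j; have /negbFE/eqP := eqAB (i, j).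
Qed.

(** * Relabelled cyclic groups *)

Section CyclicTables.
Variable n : nat.

Definition cyclic_table (s : {perm 'I_n.+1}) : table n.+1 :=
  (\matrix_(i, j) s (s^-1%g i + s^-1%g j))%R.

Lemma cyclic_tableE s a b : cyclic_table s (s a) (s b) = s (a + b)%R.
Proof. by rewrite mxE !permK. Qed.

Lemma cyclic_table_group s : is_group_table (cyclic_table s).
Proof.
exists (s 0%R), (fun i => s (- s^-1%g i)%R); rewrite /table_op.
split=> [i j k|i|i|i|i]; rewrite !mxE ?permK ?addrA ?add0r ?addr0 ?addNr ?addrN ?permKV //.
Qed.

(** Since 1 generates the cyclic group, the table computes [s (k + 1)] from [s k] and [s 1]. *)
Lemma cyclic_table_inj :
  injective (fun s => (cyclic_table s, s (inZp 1))).
Proof.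
move=> s t [eq_T eq_1].
have eq_st k : s (inZp k.+1) = t (inZp k.+1).
  elim: k => // k IHk.
  have -> : inZp k.+2 = (inZp k.+1 + inZp 1)%R :> 'I_n.+1.
    by apply: val_inj; rewrite /= modnDm addn1.
  by rewrite -!cyclic_tableE eq_T IHk eq_1.
(* The induction started at 1; every residue, 0 included, is the class of a positive integer. *)
apply/permP => x; suff <- : inZp (x + n).+1 = x by [].
by apply: val_inj; rewrite /= -addnS modnDr modn_small.
Qed.

Definition cyclic_tables : {set table n.+1} := [set cyclic_table s | s : {perm 'I_n.+1}].

Lemma card_cyclic_tables_ge : n.+1`! <= #|cyclic_tables| * n.+1.
Proof.
have sub : (fun s => (cyclic_table s, s (inZp 1))) @: [set: {perm 'I_n.+1}]
    \subset setX cyclic_tables [set: 'I_n.+1].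
  by apply/subsetP => _ /imsetP[s _ ->]; rewrite in_setX in_setT andbT imset_f.
move: (subset_leq_card sub); rewrite (card_imset _ cyclic_table_inj) cardsX !cardsT.
by rewrite card_Sn card_ord.
Qed.
End CyclicTables.

Section Bounds.
Variables (n : nat) (enc : encoding n.+1).

Lemma hybrid_rejected (P : table n.+1 -> Prop) (A B : table n.+1) :
    (forall T, P T -> is_latin_square T) -> P A -> A != B ->
  exists i, exists j, ~ P (hybrid A B i j).
Proof.
move=> latinP PA /neq_table[i [j neq]]; exists i, j => /latinP.
exact: hybrid_not_latin (latinP _ PA) neq.
Qed.

(** Stated for any property that forces Latin squares, so as to serve groups and Latin squares
    alike. *)
Lemma dnf_decides_ge (P : table n.+1 -> Prop) (S : {set table n.+1}) D :
    dnf_decides enc D P -> (forall T, P T -> is_latin_square T) ->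
    {in S, forall T, P T} ->
  #|S| <= num_terms D.
Proof.
move=> decD latinP SP; apply: (@num_terms_ge _ _ _ _ (encode enc)) => [T /SP/decD //|A B AS BS neq].
have [i [j notP]] := hybrid_rejected latinP (SP _ AS) neq.
exists (encode enc (hybrid A B i j)); first by move=> v; apply: hybrid_mix.
by apply/negP => /decD.
Qed.

(** The accepted inputs to separate are the pairs [(T, T)]: a hybrid in the first component alone
    already spoils the group property. *)
Lemma dnf_decides_group_iso_ge (S : {set table n.+1}) D :
    dnf_decides_group_iso enc D -> {in S, forall T, is_group_table T} ->
  #|S| <= num_terms D.
Proof.
move=> decD SP; apply: (@num_terms_ge _ _ _ _ (fun T => encode_pair enc T T)) => [T /SP grT|A B AS BS neq].
  apply/decD; split=> //; by exists id => //; exists id.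
have [i [j notP]] := hybrid_rejected (@group_table_latin _) (SP _ AS) neq.
exists (encode_pair enc (hybrid A B i j) A) => [[v|v] /=|]; [exact: hybrid_mix|by left|].
by apply/negP => /decD[].
Qed.
End Bounds.

(** * Asymptotics *)

From mathcomp Require Import all_classical all_reals all_analysis.
Import Order.TTheory GRing.Theory Num.Theory.
Import numFieldNormedType.Exports.
Local Open Scope classical_set_scope.
Local Open Scope ring_scope.

(** The product of the integers from [n + 1] to [2n] is at least [n ^ n], and it is [n!] times a
    binomial coefficient, which is at most [2 ^ (2n)]. *)
Lemma expnn_le_fact n : (n ^ n <= 4 ^ n * n`!)%N.
Proof.
have le_ffact : (n ^ n <= n.*2 ^_ n)%N.
  rewrite ffact_prod -[X in (n ^ X)%N]card_ord -prod_nat_const.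
  by apply: leq_prod => i _; have := ltn_ord i; lia.
apply: leq_trans le_ffact _; rewrite -bin_ffact leq_mul2r; apply/orP; right.
rewrite -[4%N]/(2 ^ 2)%N -expnM mul2n -[X in (X ^ _)%N]/(1 + 1)%N Pascal.
have lt_n : (n < n.*2.+1)%N by lia.
by rewrite (bigD1 (Ordinal lt_n)) //= !exp1n !muln1 leq_addr.
Qed.

Section Bounds.
Variable R : realType.
Implicit Types n : nat.

Let ln2_gt0 : 0 < ln 2 :> R. Proof. by rewrite ln_gt0 // ltr1n. Qed.

Lemma powR2_log2 (x : R) : 0 < x -> 2 `^ log2 x = x.
Proof.
move=> x_gt0; rewrite /powR pnatr_eq0 /= /log2 divfK ?gt_eqF //.
by rewrite lnK.
Qed.

(** Absorbs the factor [n] lost in counting cyclic tables. The case [n = 1] is apart, its logarithm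
    being 0. *)
Lemma le_powR_log2 n : (0 < n)%N -> n%:R <= n%:R `^ log2 n%:R :> R.
Proof.
case: n => // -[_|n _]; first by rewrite powR1.
rewrite le1r_powR ?ler1n // /log2 ler_pdivlMr // mul1r.
by rewrite ler_ln ?posrE ?ltr0n // ler_nat.
Qed.

(** From [ln n = 2 ln (sqrt n) <= 2 sqrt n]; it makes [n ^ log n] a mere [2 ^ O(n)]. *)
Lemma sqr_log2_le n : (0 < n)%N -> log2 n%:R ^+ 2 <= 4 / ln 2 ^+ 2 * n%:R :> R.
Proof.
move=> n_gt0; have n0 : 0 < n%:R :> R by rewrite ltr0n.
pose s : R := Num.sqrt n%:R.
have s_gt0 : 0 < s by rewrite sqrtr_gt0.
have s2 : s ^+ 2 = n%:R by rewrite sqr_sqrtr ?ltW.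
rewrite /log2 expr_div_n [leRHS]mulrAC ler_pM2r ?invr_gt0 ?exprn_gt0 //.
have -> : ln n%:R = ln s *+ 2 by rewrite -s2 lnXn.
have -> : (ln s *+ 2) ^+ 2 = 4 * ln s ^+ 2 by ring.
rewrite -s2.
have ln_s : ln s <= s by rewrite ltW ?ln_sublinear.
have ln_s0 : 0 <= ln s.
  by rewrite ln_ge0 // -sqrtr1 ler_wsqrtr // ler1n.
by rewrite ler_pM2l // ler_pXn2r // ?nnegrE ltW.
Qed.

Lemma powR2_fact_le n : (0 < n)%N ->
  2 `^ (n%:R * log2 n%:R - 2 * n%:R) <= n`!%:R :> R.
Proof.
move=> n_gt0; rewrite powRB ?pnatr_eq0 ?implybT // ler_pdivrMr ?powR_gt0 //.
rewrite mulrC powRrM powR2_log2 ?ltr0n // powR_mulrn ?ler0n //.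
rewrite powRrM !powR_mulrn ?exprn_ge0 ?ler0n // -!natrX -natrM ler_nat mulnC.
exact: expnn_le_fact.
Qed.

Lemma group_bound_asymp : exists2 f : nat -> R, f =O_\oo (fun n : nat => n%:R : R) &
  forall n : nat, (0 < n)%N -> 2 `^ (n%:R * log2 n%:R - f n) <= group_bound R n.
Proof.
(* The 2 comes from [n ^ n <= 4 ^ n * n!], the other summand from the bound on [log2 n ^+ 2]. *)
pose K : R := 2 + 4 / ln 2 ^+ 2.
exists (fun n => K * n%:R).
  apply/eqO_exP; exists `|K|; last by near=> n; rewrite normrM.
  by rewrite normr_gt0 gt_eqF // addr_gt0 // divr_gt0 // exprn_gt0.
move=> n n_gt0; have n0 : 0 < n%:R :> R by rewrite ltr0n.
rewrite /group_bound ler_pdivlMr ?powR_gt0 //.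
have -> : n%:R `^ log2 n%:R = 2 `^ (log2 n%:R ^+ 2) :> R.
  by rewrite expr2 powRrM powR2_log2.
rewrite -powRD ?pnatr_eq0 ?implybT //.
apply: le_trans (powR2_fact_le n_gt0); apply: ler_powR; first by rewrite ler1n.
have := sqr_log2_le n_gt0; rewrite /K; lra.
Unshelve. all: by end_near.
Qed.

Lemma latin_bound_asymp : exists2 f : nat -> R, f =O_\oo (fun n : nat => n%:R ^+ 2 : R) &
  forall n : nat, (0 < n)%N -> 2 `^ (n%:R ^+ 2 * log2 n%:R - f n) <= latin_bound R n.
Proof.
(* The factorial bound to the power [2n] has exponent [2 n^2 log n - 4 n^2], and the denominator
   takes away [n^2 log n]. *)
exists (fun n => 4 * n%:R ^+ 2).
  by apply/eqO_exP; exists 4 => //; near=> n; rewrite normrM ger0_norm.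
move=> n n_gt0; have n0 : 0 < n%:R :> R by rewrite ltr0n.
rewrite /latin_bound ler_pdivlMr ?exprn_gt0 //.
have := powR2_fact_le n_gt0; rewrite -(@ler_pXn2r _ (2 * n)) ?nnegrE ?powR_ge0 ?muln_gt0 //.
apply: le_trans; rewrite -(powR_mulrn (2 * n)%N (powR_ge0 _ _)).
have -> : n%:R ^+ (n ^ 2)%N = 2 `^ (log2 n%:R * (n ^ 2)%:R) :> R.
  by rewrite powRrM powR2_log2 // powR_mulrn // ltW.
rewrite -!powRrM -powRD ?pnatr_eq0 ?implybT // le_eqVlt; apply/orP; left.
by apply/eqP; congr (_ `^ _); rewrite natrM natrX; ring.
Unshelve. all: by end_near.
Qed.

End Bounds.

Theorem theorem4p2 (R : realType) :
  (forall (n : nat) (enc : encoding n), (0 < n)%N -> injective enc ->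
     [/\ forall D : dnf (table_var n),
           dnf_decides enc D (@is_group_table n) ->
           group_bound R n <= (num_terms D)%:R,
         forall D : dnf (table_var n + table_var n),
           dnf_decides_group_iso enc D ->
           group_bound R n <= (num_terms D)%:R
       & forall D : dnf (table_var n),
           dnf_decides enc D (@is_latin_square n) ->
           latin_bound R n <= (num_terms D)%:R]) /\
  (exists2 f : nat -> R, f =O_\oo (fun n : nat => n%:R : R) &
     forall n : nat, (0 < n)%N ->
       2 `^ (n%:R * log2 n%:R - f n) <= group_bound R n) /\
  (exists2 f : nat -> R, f =O_\oo (fun n : nat => n%:R ^+ 2 : R) &
     forall n : nat, (0 < n)%N ->
       2 `^ (n%:R ^+ 2 * log2 n%:R - f n) <= latin_bound R n).
Proof.
split; last by split; [exact: group_bound_asymp | exact: latin_bound_asymp].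
move=> [//|n] enc n_gt0 _; have n0 : 0 < n.+1%:R :> R by rewrite ltr0n.
have cyclic_group : {in cyclic_tables n, forall T, is_group_table T}.
  by move=> T /imsetP[s _ ->]; apply: cyclic_table_group.
have group_le m : (#|cyclic_tables n| <= m)%N -> group_bound R n.+1 <= m%:R.
  move=> le_m; rewrite /group_bound ler_pdivrMr ?powR_gt0 //.
  apply: le_trans (ler_wpM2l (ler0n _ _) (le_powR_log2 R n_gt0)).
  rewrite -natrM ler_nat (leq_trans (card_cyclic_tables_ge n)) //.
  by rewrite leq_mul2r le_m orbT.
split=> [D decD|D decD|D decD].
- exact/group_le/(dnf_decides_ge decD (@group_table_latin _)).
- exact/group_le/(dnf_decides_group_iso_ge decD).
rewrite /latin_bound ler_pdivrMr ?exprn_gt0 // -!natrX -natrM ler_nat.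
have := card_latin_rectangles_ge (leqnn n.+1).
(* With all [n.+1] rows the falling factorial is the full factorial, so both factors are the same
   power of it. *)
rewrite ffactnn -expnD addnn -mul2n mulnn => /leq_trans-> //.
rewrite leq_mul2r -(card_imset _ (@table_of_rows_inj n)) expn_eq0 /=.
apply: (dnf_decides_ge decD) => // _ /imsetP[t t_lat ->].
exact: table_of_rows_latin.
Qed.
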